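(* Let $L$ be a hyperbolic lattice of signature $(1,r+1)$ with $r\ge 0$ and let $e\in L$ be a primitive element such that $(e,e)=0$. Let $G\subset\mathrm{SO}(L)(\mathbb{Z})$ be a subgroup such that $G\simeq\mathbb{Z}^r$ as a group and such that $g(e)=e$ for all $g\in G$. Then any $G$-stable $\mathbb{R}$-linear subspace $M$ of $L_{\mathbb{R}}$ is contained in the hypersurface $e^{\perp}$ of $L_{\mathbb{R}}$, or $M=L_{\mathbb{R}}$.
   Context: A hyperbolic lattice of signature $(1,t)$, $t>0$, is a free $\mathbb{Z}$-module $L$ of rank $1+t$ together with a $\mathbb{Z}$-valued symmetric bilinear form $(\cdot,\cdot)$ of signature $(1,t)$. Write $L_{\mathbb{R}}=L\otimes_{\mathbb{Z}}\mathbb{R}$, with the form extended $\mathbb{R}$-bilinearly. $\mathrm{SO}(L)(\mathbb{Z})$ is the group of isometries of $L$ of determinant $1$; it acts on $L_{\mathbb{R}}$ by $\mathbb{R}$-linear extension. Here $e^{\perp}=\{x\in L_{\mathbb{R}} : (x,e)=0\}$.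
   Formalization: The case r = 0 is excluded (r ≥ 1 is assumed), because there the claim is false: for the hyperbolic plane with isotropic basis e, f and G trivial, the line M = ℝf is G-stable but is neither contained in e^⊥ = ℝe nor equal to L_ℝ. *)

(* Defs.v *)
From HB Require Import structures.
From mathcomp Require Import all_boot all_order all_algebra.
From mathcomp Require Import all_classical all_reals.

Set Implicit Arguments.
Unset Strict Implicit.
Unset Printing Implicit Defensive.

Import Order.TTheory GRing.Theory Num.Theory.
Local Open Scope classical_set_scope.
Local Open Scope ring_scope.

(* A free Z-module of rank n with a symmetric bilinear form is given, in a
   Z-basis, as 'rV[int]_n with a symmetric Gram matrix B : 'M[int]_n, and its
   extension of scalars to R is 'rV[R]_n.  Vectors are rows, so a linear map g
   is x |-> x *m g. *)

Notation realify R A := (map_mx (fun z : int => z%:~R : R) A).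

Definition bform (K : comNzRingType) (n : nat) (B : 'M[K]_n) (x y : 'rV[K]_n)
    : K :=
  (x *m B *m y^T) 0 0.

(* The rows of P are a basis in which the Gram matrix is diag(1^p, (-1)^q). *)
Definition has_signature (R : realType) (n : nat) (A : 'M[R]_n) (p q : nat)
    : Prop :=
  (p + q)%N = n /\
  exists2 P : 'M[R]_n, P \in unitmx &
    P *m A *m P^T = diag_mx (\row_(i < n) (if (i < p)%N then 1 else -1)).

Definition hyperbolic_lattice (R : realType) (t : nat) (B : 'M[int]_(t.+1))
    : Prop :=
  [/\ (0 < t)%N, B^T = B & has_signature (realify R B) 1 t].

Definition primitive (n : nat) (e : 'rV[int]_n) : Prop :=
  e != 0 /\ forall (k : int) (w : 'rV[int]_n), e = k *: w -> k = 1 \/ k = -1.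

Definition isometry (n : nat) (B g : 'M[int]_n) : Prop :=
  g \in unitmx /\
  forall x y : 'rV[int]_n, bform B (x *m g) (y *m g) = bform B x y.

Definition SO (n : nat) (B : 'M[int]_n) : set 'M[int]_n :=
  [set g | isometry B g /\ \det g = 1].

Definition is_subgroup (n : nat) (H G : set 'M[int]_n) : Prop :=
  [/\ G `<=` H, G 1%:M,
      forall g h, G g -> G h -> G (g *m h) &
      forall g, G g -> G (invmx g)].

Definition isomorphic_to_Zpow (r n : nat) (G : set 'M[int]_n) : Prop :=
  exists phi : 'rV[int]_r -> 'M[int]_n,
    (forall u v, phi (u + v) = phi u *m phi v) /\
    set_bij [set: 'rV[int]_r] G phi.

Definition stable (R : realType) (n : nat) (G : set 'M[int]_n)
    (M : {vspace 'rV[R]_n}) : Prop :=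
  forall g, G g -> forall x, x \in M -> x *m realify R g \in M.

Definition perp (R : realType) (n : nat) (B : 'M[int]_n) (e : 'rV[int]_n)
    : {pred 'rV[R]_n} :=
  [pred x | bform (realify R B) x (realify R e) == 0].

(* Main.v *)
From HB Require Import structures.
Require Import Defs.
From mathcomp Require Import all_boot all_order fingroup cyclic all_algebra.
From mathcomp Require Import all_classical all_reals.
From mathcomp Require Import zify ring lra.

Set Implicit Arguments.
Unset Strict Implicit.
Unset Printing Implicit Defensive.

Import Order.TTheory GRing.Theory Num.Theory.
Local Open Scope classical_set_scope.
Local Open Scope ring_scope.

(**
Write A for the real Gram matrix and e^perp for the orthogonal of e.  Since the
signature is (1, r+1), the form is negative semidefinite on e^perp, and its
only isotropic vectors there are the multiples of e.  So e^perp / Re is a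
negative definite space of dimension r in which e^perp (intersected with the
lattice) has a discrete image; a subgroup of finite index of G acts on it
trivially, that is, by transvections of the kind called [unipotent_at] below.

Finite index is obtained from congruences instead of from the finiteness of the
orthogonal group of a definite lattice.  For every m there is an N such that
the N-th powers of invertible integral matrices are 1 mod m ([expmx_congr1]).
If g = 1 mod m fixes e and v is an integral vector of e^perp, then v g - v = m
w with w integral, while by the parallelogram law the norm of v g - v is at
most 4 times the norm of v; for large m this forces w to be isotropic, hence
proportional to e.  Taking v in a finite integral spanning set of e^perp gives
[congr1_unipotent_at].

Fix f in the lattice with (f,e) <> 0 and let Psi(a) = phi(N a), where phi is the
isomorphism from Z^r to G.  The map a |-> f Psi(a) - f mod e is additive,
because Psi(b) acts trivially on e^perp / Re, and injective, because a
transvection is determined by f g - f mod e ([unipotent_eq1]).  Hence e and the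
r vectors w_i = f Psi(u_i) - f, for u_i the standard basis, are integral and
independent over Z, so also over R ([unipotent_orbit_row_free]); counting
dimensions, they span e^perp.

Now let x in M be outside e^perp, and put g = Psi(u_i) for some i, which exists
since r > 0.  Then x (g - 1)^2 is a nonzero multiple of e
([unipotent_sub_sqr]), so e is in M.  As x is a multiple of f modulo e^perp,
each x (Psi(u_i) - 1) is a nonzero multiple of w_i modulo e, so all the w_i are
in M.  Thus M contains e^perp and x, and is everything.
*)

(** * Symmetric bilinear forms given by a Gram matrix *)

Section BilinearForm.
Variables (K : comNzRingType) (n : nat) (A : 'M[K]_n).
Implicit Types (x y z : 'rV[K]_n) (a : K).

Lemma bformDl x y z : bform A (x + y) z = bform A x z + bform A y z.
Proof. by rewrite /bform !mulmxDl mxE. Qed.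

Lemma bformZl a x y : bform A (a *: x) y = a * bform A x y.
Proof. by rewrite /bform -!scalemxAl mxE. Qed.

Lemma bformNl x y : bform A (- x) y = - bform A x y.
Proof. by rewrite -scaleN1r bformZl mulN1r. Qed.

Hypothesis symA : A^T = A.

Lemma bformC x y : bform A x y = bform A y x.
Proof.
rewrite /bform; have -> : x *m A *m y^T = (y *m A *m x^T)^T.
  by rewrite !trmx_mul symA trmxK mulmxA.
by rewrite mxE.
Qed.

Lemma bformDr x y z : bform A z (x + y) = bform A z x + bform A z y.
Proof. by rewrite !(bformC z) bformDl. Qed.

Lemma bformZr a x y : bform A y (a *: x) = a * bform A y x.
Proof. by rewrite !(bformC y) bformZl. Qed.

Lemma bformNr x y : bform A y (- x) = - bform A y x.
Proof. by rewrite !(bformC y) bformNl. Qed.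

End BilinearForm.

Lemma isometry_gram (n : nat) (B g : 'M[int]_n) :
  Defs.isometry B g -> g *m B *m g^T = B.
Proof.
case=> _ iso; apply/matrixP => i j.
have E (C : 'M[int]_n) : bform C (delta_mx 0 i) (delta_mx 0 j) = C i j.
  by rewrite /bform trmx_delta -rowE -colE !mxE.
rewrite -E -[RHS]E -(iso (delta_mx 0 i)) /bform.
by rewrite trmx_mul !mulmxA.
Qed.

(** * From integer to real matrices *)

Lemma realify_inj (R : realType) (m n : nat) :
  injective (fun W : 'M[int]_(m, n) => realify R W).
Proof.
move=> W W' /matrixP eqW; apply/matrixP => i j.
by apply: (intr_inj (R := R)); have := eqW i j; rewrite !mxE.
Qed.

Lemma bform_realify (R : realType) (n : nat) (B : 'M[int]_n)
    (x y : 'rV[int]_n) :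
  bform (realify R B) (realify R x) (realify R y) = (bform B x y)%:~R.
Proof. by rewrite /bform map_trmx -!map_mxM [LHS]mxE. Qed.

(** Linear independence of integer vectors does not depend on the field of
coefficients, and over the rationals one can clear denominators. *)
Lemma row_free_realify (R : realType) (m n : nat) (W : 'M[int]_(m, n)) :
  (forall a : 'rV[int]_m, a *m W = 0 -> a = 0) -> row_free (realify R W).
Proof.
move=> indep.
have -> : realify R W = map_mx ratr (map_mx intr W : 'M[rat]_(m, n)).
  by apply/matrixP => i j; rewrite !mxE ratr_int.
rewrite row_free_map; apply: inj_row_free => v vW0.
(* d clears the denominators of v, and a is the integral vector d v *)
pose d := \prod_j denq (v 0 j).
have d_neq0 : d%:~R != 0 :> rat.
  by rewrite intr_eq0; apply/prodf_neq0 => j _; exact: denq_neq0.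
pose a : 'rV[int]_m :=
  \row_j (numq (v 0 j) * \prod_(k | k != j) denq (v 0 k)).
have aE : map_mx intr a = d%:~R *: v :> 'rV[rat]_m.
  apply/rowP => j; rewrite !mxE /d [in RHS](bigD1 j) //= !intrM mulrAC.
  by rewrite numqE [_ * v 0 j]mulrC.
have a0 : a = 0.
  apply: indep; apply/rowP => j; apply: (intr_inj (R := rat)).
  have /rowP/(_ j) : map_mx intr a *m map_mx intr W = 0 :> 'rV[rat]_n.
    by rewrite aE -scalemxAl vW0 scaler0.
  by rewrite -map_mxM !mxE.
by apply: (scalerI d_neq0); rewrite scaler0 -aE a0 map_mx0.
Qed.

(** * Powers congruent to the identity *)

Lemma Zp_intr_eq0 (m : nat) (z : int) : z%:~R = 0 :> 'I_m.+2 -> (m.+2 %| z)%Z.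
Proof.
have nat_case k : k%:R = 0 :> 'I_m.+2 -> (m.+2 %| k)%N.
  by rewrite Zp_nat => /(congr1 val)/= k0; apply/eqP.
case: z => k; rewrite dvdzE; first exact: nat_case.
by rewrite NegzE mulrNz -pmulrn => /eqP; rewrite oppr_eq0 => /eqP/nat_case.
Qed.

(** N is the order of the finite group of invertible matrices over Z/m, so it
serves all g at once; this uniformity makes a |-> phi(N a) a homomorphism into
the matrices congruent to 1. *)
Lemma expmx_congr1 (n m : nat) : (1 < m)%N ->
  exists2 N, (0 < N)%N &
    forall g : 'M[int]_n.+1, g \in unitmx ->
      exists X : 'M[int]_n.+1, g ^+ N = 1 + m%:R *: X.
Proof.
case: m => [|[|m]] // _.
pose Zm := 'I_m.+2.
exists #|[set: {unit 'M[Zm]_n.+1}]%G|; first exact: cardG_gt0.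
move=> g gU; set N := #|_|.
have red_g : map_mx intr g \is a @GRing.unit 'M[Zm]_n.+1.
  apply: (rmorph_unit (map_mx intr)); exact: gU.
pose u : {unit 'M[Zm]_n.+1} := FinRing.unit 'M[Zm]_n.+1 red_g.
have : (u ^+ N = 1)%g by apply: expg_cardG; rewrite inE.
move/(congr1 val); rewrite FinRing.val_unitX /= -rmorphXn /= => gN1.
have dvd i j : (m.+2 %| (g ^+ N - 1) i j)%Z.
  have : ((g ^+ N - 1) i j)%:~R = 0 :> Zm.
    by have /matrixP/(_ i j) := gN1; rewrite !mxE rmorphB /= => ->;
       rewrite rmorph_nat subrr.
  exact/Zp_intr_eq0.
exists (\matrix_(i, j) ((g ^+ N - 1) i j %/ m.+2)%Z).
suff <- : g ^+ N - 1 = m.+2%:R *: \matrix_(i, j) ((g ^+ N - 1) i j %/ m.+2)%Z.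
  by rewrite addrC subrK.
apply/matrixP => i j; rewrite [RHS]mxE [X in _ = _ * X]mxE mulrC.
by rewrite -{1}(divzK (dvd i j)) natz.
Qed.

(** * Signature (1,t) and the orthogonal of an isotropic vector *)

Lemma signature_unitmx (R : realType) (n : nat) (A : 'M[R]_n) (p q : nat) :
  has_signature A p q -> A \in unitmx.
Proof.
case=> _ [P Punit]; set D := diag_mx _ => AE.
have DD : D *m D = 1%:M.
  rewrite mulmx_diag -diag_const_mx; congr diag_mx; apply/rowP => i.
  by rewrite !mxE; case: ifP; rewrite ?mulr1 ?mulrNN ?mulr1.
have [Dunit _] := mulmx1_unit DD.
have PTunit : P^T \in unitmx by rewrite unitmx_tr.
by rewrite -[A](mulKmx Punit) -[P *m A](mulmxK PTunit) AE !unitmx_mul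
  !unitmx_inv Punit Dunit.
Qed.

(** In the coordinates where the form is diag(1, -1, ..., -1), the hyperplane
l = 0 is the vanishing of the first coordinate. *)
Lemma bform_nonpos_hyperplane (R : realType) (t : nat) (A : 'M[R]_t.+1) :
  has_signature A 1 t ->
  exists l : 'cV[R]_t.+1, forall x, (x *m l) 0 0 = 0 ->
    bform A x x <= 0 /\ (bform A x x = 0 -> x = 0).
Proof.
case=> _ [P Punit AE]; exists (col ord0 (invmx P)) => x.
rewrite colE mulmxA -colE mxE => z0.
have : x = x *m invmx P *m P by rewrite mulmxKV.
move: (x *m invmx P) z0 => z z0 xE.
have qE : bform A x x = - \sum_(j < t.+1) z 0 j ^+ 2.
  rewrite /bform xE trmx_mul !mulmxA -2!(mulmxA z) AE mxE -sumrN.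
  apply: eq_bigr => j _; rewrite mul_mx_diag !mxE.
  case: ltnP => [|_]; last by rewrite mulrN1 mulNr.
  rewrite ltnS leqn0 => /eqP j0.
  have -> : j = ord0 by apply: val_inj.
  by rewrite z0 !mul0r expr0n oppr0.
rewrite qE oppr_le0; split; first by apply: sumr_ge0 => j _; exact: sqr_ge0.
move/eqP; rewrite oppr_eq0 psumr_eq0 => [/allP z_eq0|j _]; last exact: sqr_ge0.
suff z00 : z = 0 by rewrite xE z00 mul0mx.
apply/rowP => j; rewrite mxE; apply/eqP.
by rewrite -sqrf_eq0; apply: z_eq0; rewrite mem_index_enum.
Qed.

(** Translating by a multiple of e changes neither (y,y) nor the hypothesis, so
y may be moved into a hyperplane on which the form is negative definite. *)
Lemma isotropic_perp_nonpos (R : realType) (t : nat) (A : 'M[R]_t.+1)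
    (e y : 'rV[R]_t.+1) :
  A^T = A -> has_signature A 1 t -> e != 0 -> bform A e e = 0 ->
  bform A y e = 0 ->
  bform A y y <= 0 /\ (bform A y y = 0 -> (y <= e)%MS).
Proof.
move=> symA /bform_nonpos_hyperplane [l neg] e_neq0 ee0 ye0.
have le_neq0 : (e *m l) 0 0 != 0.
  by apply: contra_neq e_neq0 => /neg [_]; exact.
pose k := (y *m l) 0 0 / (e *m l) 0 0.
have [|] := neg (y - k *: e).
  rewrite mulmxBl -scalemxAl mxE [X in _ + X]mxE [X in _ - X]mxE.
  by rewrite divfK // subrr.
have -> : bform A (y - k *: e) (y - k *: e) = bform A y y.
  rewrite !(bformDl, bformDr, bformNl, bformNr, bformZl, bformZr) //.
  by rewrite ee0 (bformC symA e) ye0 !(mulr0, oppr0, addr0).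
move=> le0 eq0; split=> // /eq0/eqP; rewrite subr_eq0 => /eqP ->.
exact: scalemx_sub.
Qed.

(** * Isometries acting trivially on e^perp / e *)

Section Transvection.
Variables (R : realFieldType) (n : nat) (A : 'M[R]_n) (e : 'rV[R]_n).
Hypotheses (symA : A^T = A) (ee0 : bform A e e = 0).
Hypothesis perp_isotropic :
  forall y, bform A y e = 0 -> bform A y y = 0 -> (y <= e)%MS.

(** The stabilizer of e acts on e^perp / Re; these are the elements of the
kernel, which form the unipotent radical of the stabilizer (Eichler
transvections). *)
Definition unipotent_at (g : 'M[R]_n) : Prop :=
  [/\ forall x y, bform A (x *m g) (y *m g) = bform A x y, e *m g = e &
      forall y, bform A y e = 0 -> (y *m g - y <= e)%MS].

Lemma bform_fixed_perp g (x : 'rV[R]_n) :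
  unipotent_at g -> bform A (x *m g - x) e = 0.
Proof. by case=> iso eg _; rewrite bformDl bformNl -{1}eg iso subrr. Qed.

(** So g |-> f g - f is a homomorphism modulo e: the defect is the effect of
h - 1 on f g - f, which lies in e^perp. *)
Lemma unipotent_mulmx_sub g h (f : 'rV[R]_n) :
  unipotent_at g -> unipotent_at h ->
  ((f *m (g *m h) - f) - (f *m g - f) - (f *m h - f) <= e)%MS.
Proof.
move=> ug [_ _ uh]; have := uh _ (bform_fixed_perp f ug).
rewrite mulmxBl mulmxA; congr (_ <= _)%MS.
rewrite !opprB !addrA subrK -!addrA; congr (_ + _).
by rewrite addrCA [RHS]addrCA [in RHS](addrC (- _)).
Qed.

Variable f : 'rV[R]_n.
Hypothesis fe_neq0 : bform A f e != 0.

(** Write f g = f + a e.  Preserving (f,f) gives 2 a (f,e) = 0, so g fixes f;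
for v in e^perp with v g = v + b e, preserving (f,v) gives b (f,e) = 0, so g
fixes e^perp, and f and e^perp span. *)
Lemma unipotent_eq1 g : unipotent_at g -> (f *m g - f <= e)%MS -> g = 1%:M.
Proof.
move=> [iso eg ug] /sub_rVP [a fgE].
have fg : f *m g = f.
  apply/eqP; rewrite -subr_eq0 fgE.
  have := iso f f; rewrite -(subrK f (f *m g)) fgE.
  rewrite !(bformDl, bformDr, bformZl, bformZr) // ee0 (bformC symA e).
  move=> h; have : 2 * a * bform A f e = 0 by move: h; lra.
  by move/eqP; rewrite !mulf_eq0 (negPf fe_neq0) orbF pnatr_eq0 /=
    => /eqP ->; rewrite scale0r.
have fix_perp v : bform A v e = 0 -> v *m g = v.
  move=> ve0; have /sub_rVP [b vgE] := ug v ve0.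
  apply/eqP; rewrite -subr_eq0 vgE.
  have := iso f v; rewrite fg -{1}(subrK v (v *m g)) vgE bformDr // bformZr //.
  move=> h; have : b * bform A f e = 0 by move: h; lra.
  by move/eqP; rewrite !mulf_eq0 (negPf fe_neq0) orbF
    => /eqP ->; rewrite scale0r.
apply/row_matrixP => i; rewrite !rowE mulmx1; set x := delta_mx _ _.
pose k := bform A x e / bform A f e.
have : bform A (x - k *: f) e = 0.
  by rewrite bformDl bformNl bformZl /k divfK ?subrr.
move/fix_perp; rewrite mulmxBl -scalemxAl fg => /addIr; exact.
Qed.

(** With w = f g - f and w g = w + c e, preserving (w,f) gives
(w,w) + c (e,f + w) = 0.  If c were 0, then w would be isotropic in e^perp, so
proportional to e, and g would be 1. *)
Lemma unipotent_sub_sqr g : unipotent_at g -> g != 1%:M ->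
  exists2 c, c != 0 & (f *m g - f) *m g - (f *m g - f) = c *: e.
Proof.
move=> ug g_neq1; have we0 := bform_fixed_perp f ug.
have w_notin : ~~ (f *m g - f <= e)%MS.
  by apply: contra_neqN g_neq1; exact: unipotent_eq1.
case: ug => iso eg ug; have /sub_rVP [c wgE] := ug _ we0.
exists c => //; apply: contraNneq w_notin => c0.
apply: perp_isotropic => //; move: wgE; rewrite c0 scale0r.
set w := f *m g - f => /eqP; rewrite subr_eq0 => /eqP wg.
have := iso w f; rewrite wg -(subrK f (f *m g)) -/w bformDr //.
by move=> h; apply: (addIr (bform A w f)); rewrite h add0r.
Qed.

End Transvection.

(** * Congruence subgroups consist of transvections *)

(** The projection onto e^perp along f, multiplied by (f,e) to be integral; its
rows are therefore a finite set of integral vectors that span e^perp. *)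
Definition perp_proj (n : nat) (B : 'M[int]_n) (e f : 'rV[int]_n) : 'M[int]_n :=
  bform B f e *: 1%:M - B *m e^T *m f.

Lemma perp_proj_perp (n : nat) (B : 'M[int]_n) (e f : 'rV[int]_n) (i : 'I_n) :
  bform B (row i (perp_proj B e f)) e = 0.
Proof.
have fBe : f *m (B *m e^T) = (bform B f e)%:M.
  by rewrite mulmxA [LHS]mx11_scalar.
rewrite /bform -!row_mul -mulmxA /perp_proj mulmxBl -scalemxAl mul1mx.
by rewrite -(mulmxA _ f) fBe mul_mx_scalar subrr !mxE.
Qed.

Lemma mulmx_perp_proj (R : realType) (n : nat) (B : 'M[int]_n)
    (e f : 'rV[int]_n) (y : 'rV[R]_n) :
  bform (realify R B) y (realify R e) = 0 ->
  y *m realify R (perp_proj B e f) = (bform B f e)%:~R *: y.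
Proof.
move=> ye0; rewrite map_mxB map_mxZ map_mx1 !map_mxM -map_trmx mulmxBr.
rewrite -scalemxAr mulmx1 !mulmxA [y *m _ *m _]mx11_scalar.
by rewrite [_ 0 0]ye0 mul_scalar_mx scale0r subr0.
Qed.

Section Lattice.
Variables (R : realType) (t : nat) (B : 'M[int]_t.+1) (e f : 'rV[int]_t.+1).
Hypotheses (symB : B^T = B) (sigB : has_signature (realify R B) 1 t).
Hypotheses (e_neq0 : e != 0) (ee0 : bform B e e = 0).
Let A := realify R B.
Let eR := realify R e.

Lemma realify_sym : A^T = A.
Proof. by rewrite /A map_trmx symB. Qed.

Lemma realify_neq0 : eR != 0.
Proof.
by apply: contra_neq e_neq0 => eR0; apply: (@realify_inj R); rewrite map_mx0.
Qed.

Lemma realify_isotropic : bform A eR eR = 0.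
Proof. by rewrite bform_realify ee0. Qed.

Lemma realify_perp_nonpos (x : 'rV[int]_t.+1) :
  bform B x e = 0 ->
  bform B x x <= 0 /\ (bform B x x = 0 -> (realify R x <= eR)%MS).
Proof.
move=> xe0.
have [|] := @isotropic_perp_nonpos R t A eR (realify R x) realify_sym sigB
  realify_neq0 realify_isotropic; first by rewrite bform_realify xe0.
rewrite bform_realify lerz0 => le0 eq0; split=> // xx0.
by apply: eq0; rewrite xx0.
Qed.

(** It suffices to treat the rows v of [perp_proj].  Such a v is moved by m w
with w integral in e^perp, and -(m w, m w) <= -4 (v,v) < m, so the integer (w,w)
vanishes. *)
Lemma congr1_unipotent_at (m : nat) (g X : 'M[int]_t.+1) :
  bform B f e != 0 ->
  (forall i, let v := row i (perp_proj B e f) in 4 * `|bform B v v| < m%:Z) ->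
  Defs.isometry B g -> e *m g = e -> g = 1%:M + m%:R *: X ->
  unipotent_at A eR (realify R g).
Proof.
move=> fe_neq0 m_large gB eg gE.
have iso := gB.2.
split.
- move=> x y; rewrite /bform trmx_mul !mulmxA -(mulmxA x) -(mulmxA x).
  by rewrite map_trmx -!map_mxM isometry_gram.
- by rewrite -map_mxM eg.
move=> y ye0; set V := perp_proj B e f.
have VgV : (realify R V *m realify R g - realify R V <= eR)%MS.
  apply/row_subP => i; rewrite -map_mxM -map_mxB -map_row.
  rewrite linearB /= row_mul; have := m_large i; rewrite -/V /=.
  have : bform B (row i V) e = 0 by exact: perp_proj_perp.
  move: (row i V) => v ve0 m_gt.
  pose w := v *m X.
  have vgE : v *m g - v = m%:Z *: w.
    by rewrite gE mulmxDr mulmx1 addrC addKr -scalemxAr natz.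
  have vge0 : bform B (v *m g) e = 0 by rewrite -{1}eg iso.
  have m_gt0 : 0 < m%:Z by apply: le_lt_trans m_gt; rewrite mulr_ge0.
  have we0 : bform B w e = 0.
    apply: (mulfI (lt0r_neq0 m_gt0)).
    by rewrite -bformZl -vgE bformDl bformNl vge0 ve0 subr0 mulr0.
  have [ww_le0 ww0] := realify_perp_nonpos we0.
  have [vv_le0 _] := realify_perp_nonpos ve0.
  have [|s_le0 _] := @realify_perp_nonpos (v *m g + v).
    by rewrite bformDl vge0 ve0.
  (* the parallelogram law for v g and v, which have the same norm *)
  have par : m%:Z * (m%:Z * bform B w w) + bform B (v *m g + v) (v *m g + v)
      = 4 * bform B v v.
    have -> : m%:Z * (m%:Z * bform B w w) = bform B (v *m g - v) (v *m g - v).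
      by rewrite vgE bformZl bformZr.
    rewrite !(bformDl, bformDr, bformNl, bformNr) // iso; ring.
  suff /ww0 w_le : bform B w w = 0.
    by rewrite vgE map_mxZ; exact: scalemx_sub.
  apply/eqP; rewrite eq_le ww_le0 leNgt /=; apply/negP => ww_lt0.
  move: m_gt; rewrite ler0_norm // => m_gt.
  have ww_le : bform B w w <= -1 by move: ww_lt0; lia.
  clear -par m_gt s_le0 ww_le m_gt0.
  by move: m_gt0 ww_le m_gt s_le0 par; nia.
have : ((bform B f e)%:~R *: (y *m realify R g - y) <= eR)%MS.
  rewrite scalerBr scalemxAl -mulmx_perp_proj // -mulmxA -mulmxBr.
  exact: mulmx_sub.
by rewrite eqmx_scale // intr_eq0.
Qed.

(** If a1 e + a2 D = 0, then the additive map a |-> f Psi(a) - f mod e kills a2,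
so Psi(a2) = 1 and a2 = 0. *)
Lemma unipotent_orbit_row_free (r : nat) (Psi : 'rV[int]_r -> 'M[int]_t.+1) :
  bform B f e != 0 ->
  (forall a b, Psi (a + b) = Psi a *m Psi b) ->
  (forall a, unipotent_at A eR (realify R (Psi a))) ->
  (forall a, Psi a = 1%:M -> a = 0) ->
  row_free (realify R (col_mx e (\matrix_i (f *m Psi (delta_mx 0 i) - f)))).
Proof.
move=> fe_neq0 PsiD uni Psi_inj; set D := \matrix_i _.
(* multiplying by [cokermx eR] is passing to the quotient by the line of e *)
pose p a := realify R (f *m Psi a - f) *m cokermx eR.
have p_add : {morph p : a b / a + b}.
  move=> a b; apply/eqP; rewrite -subr_eq0 opprD addrA -!mulmxBl -submxE.
  rewrite !map_mxB !map_mxM PsiD map_mxM.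
  exact: unipotent_mulmx_sub (uni a) (uni b).
have p_sub : zmod_morphism p.
  by move=> a b; have := p_add (a - b) b; rewrite subrK => ->; rewrite addrK.
pose pA : {additive 'rV[int]_r -> 'rV[R]_t.+1} :=
  HB.pack p (GRing.isZmodMorphism.Build _ _ p p_sub).
have pE a : p a = realify R (a *m D) *m cokermx eR.
  rewrite [a in LHS]row_sum_delta -[p _]/(pA _) raddf_sum [a *m D]mulmx_sum_row.
  rewrite [map_mx _ _]raddf_sum mulmx_suml; apply: eq_bigr => i _.
  by rewrite -{1}[a 0 i]intz scaler_int raddfMz /= /p map_mxZ -scalemxAl rowK
    scaler_int.
apply: row_free_realify => a.
rewrite -[a]hsubmxK mul_row_col; set a1 := lsubmx a; set a2 := rsubmx a => aW0.
have a20 : a2 = 0.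
  apply: Psi_inj; apply: (@realify_inj R); rewrite map_mx1.
  apply: (unipotent_eq1 (f := realify R f) realify_sym realify_isotropic _
    (uni a2)).
    by rewrite bform_realify intr_eq0.
  rewrite -map_mxM -map_mxB submxE -[_ *m _]/(p a2) pE -submxE.
  move/eqP: aW0; rewrite addrC addr_eq0 => /eqP ->.
  by rewrite map_mxN eqmx_opp map_mxM submxMl.
move: aW0; rewrite a20 mul0mx addr0 [a1]mx11_scalar mul_scalar_mx => /eqP.
rewrite scalemx_eq0 (negPf e_neq0) orbF => /eqP ->.
by rewrite -row_mx0 raddf0.
Qed.

End Lattice.

(** * Stable subspaces *)

Lemma kermx_sub_row_free (K : fieldType) (n : nat) (W : 'M[K]_(n, n.+1))
    (c : 'cV[K]_n.+1) :
  row_free W -> W *m c = 0 -> c != 0 -> (kermx c <= W)%MS.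
Proof.
move=> Wfree /sub_kermxP Wker c_neq0.
rewrite -(geq_leqif (mxrank_leqif_sup Wker)) mxrank_ker (eqP Wfree).
have : (0 < \rank c)%N by rewrite lt0n mxrank_eq0.
lia.
Qed.

(* The case r = 0 is excluded: it is false.  In the lattice of rank 2 with
   basis e, f and (e,e) = (f,f) = 0, (e,f) = 1, the line spanned by f is
   stable under the trivial group, is not in the orthogonal of e and is not
   the whole plane. *)
Theorem theorem4p6 (R : realType) (r : nat) (hr : (0 < r)%N)
    (B : 'M[int]_(r.+2)) (hB : hyperbolic_lattice R B)
    (e : 'rV[int]_(r.+2)) (he : primitive e) (hee : bform B e e = 0)
    (G : set 'M[int]_(r.+2)) (hG : is_subgroup (SO B) G)
    (hiso : isomorphic_to_Zpow r G)
    (hfix : forall g, G g -> e *m g = e)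
    (M : {vspace 'rV[R]_(r.+2)}) (hM : stable G M) :
  {subset M <= perp B e} \/ M = fullv.
Proof.
have [_ symB sigB] := hB; have e_neq0 := he.1.
pose A := realify R B; pose eR := realify R e.
have eR_neq0 : eR != 0 by exact: realify_neq0.
have symA : A^T = A by exact: realify_sym.
have eeR0 : bform A eR eR = 0 by exact: realify_isotropic.
have isoR y : bform A y eR = 0 -> bform A y y = 0 -> (y <= eR)%MS.
  by move=> ye0; have [_] := isotropic_perp_nonpos symA sigB eR_neq0 eeR0 ye0.
have BeR_neq0 : A *m eR^T != 0.
  apply: contra_neq eR_neq0 => Ae0; apply: trmx_inj.
  by rewrite -(mulKmx (signature_unitmx sigB) eR^T) Ae0 mulmx0 trmx0.
have [f fe_neq0] : exists f : 'rV[int]_r.+2, bform B f e != 0.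
  apply: contrapT => nof; move/eqP: BeR_neq0; apply.
  rewrite /A /eR map_trmx -map_mxM -[RHS](map_mx0 intr); congr map_mx.
  apply/colP => i; rewrite [RHS]mxE; apply/eqP/negPn/negP => Bei_neq0.
  by apply: nof; exists (delta_mx 0 i); rewrite /bform -rowE -row_mul mxE.
have [phi [phiD [phiG phi_inj phi_surj]]] := hiso.
(* m exceeds the bound of [congr1_unipotent_at] for every row; the summand 2
   makes m > 1, so that Z/m is a nontrivial ring *)
pose q i := let v := row i (perp_proj B e f) in 4 * `|bform B v v|.
pose m := (2 + \sum_i absz (q i))%N.
have q_lt i : q i < m%:Z.
  have q_ge0 : 0 <= q i by rewrite mulr_ge0.
  move: (q) q_ge0 @m => q' q'_ge0; rewrite (bigD1 i) //=; lia.
have [N N_gt0 expN] := @expmx_congr1 r.+1 m isT.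
pose Psi (a : 'rV[int]_r) := phi (a *+ N).
have PsiD a b : Psi (a + b) = Psi a *m Psi b by rewrite /Psi mulrnDl phiD.
have PsiG a : G (Psi a) by exact: phiG.
have phi0 : phi 0 = 1%:M.
  have [_ G1 _ _] := hG; have [a _ aE] := phi_surj _ G1.
  by have := phiD a 0; rewrite addr0 aE mul1mx.
have PsiE a : Psi a = phi a ^+ N.
  rewrite /Psi; elim: N {N_gt0 expN Psi PsiD PsiG} => [|N IH].
    by rewrite mulr0n phi0.
  by rewrite mulrS phiD IH exprS.
have Psi_inj a : Psi a = 1%:M -> a = 0.
  rewrite -phi0 => /phi_inj; rewrite !in_setT => /(_ isT isT) aN0.
  apply/rowP => i; move/rowP/(_ i): aN0; rewrite !mxE mulmxnE => /eqP.
  by rewrite mulrn_eq0 eqn0Ngt N_gt0 => /eqP.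
have [GSO _ _ _] := hG.
have Psi_uni a : unipotent_at A eR (realify R (Psi a)).
  have [gB _] := GSO _ (phiG a I).
  have [X gNE] := expN _ gB.1.
  apply: (@congr1_unipotent_at R _ B e f symB sigB e_neq0 hee m _ X) => //.
  - exact: (GSO _ (PsiG a)).1.
  - exact: hfix.
  - by rewrite PsiE.
have := unipotent_orbit_row_free (R := R) symB e_neq0 hee fe_neq0 PsiD
  Psi_uni Psi_inj.
set W := realify R _ => Wfree.
have [Msub|] := pselect ({subset M <= perp B e}); first by left.
move=> Mperp; right.
have [x xM xe_neq0] : exists2 x, x \in M & bform A x eR != 0.
  apply: contrapT => noex; apply: Mperp => x xM; rewrite inE.
  by apply/negPn/negP => xe; apply: noex; exists x.
have M_sub a y : y \in M -> y *m realify R (Psi a) - y \in M.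
  by move=> yM; rewrite memvB // hM.
(* e is, up to a nonzero factor, x (g - 1)^2 for any g = Psi(a) other than 1 *)
have eM : eR \in M.
  pose i0 := Ordinal hr; pose g := Psi (delta_mx 0 i0).
  have g_neq1 : realify R g != 1%:M.
    apply/eqP; rewrite -[1%:M](map_mx1 intr) => /realify_inj/Psi_inj.
    by move/rowP/(_ i0); rewrite !mxE !eqxx.
  have [c c_neq0 cE] := unipotent_sub_sqr symA eeR0 isoR xe_neq0
    (Psi_uni _) g_neq1.
  have : c *: eR \in M by rewrite -cE; apply: (M_sub _ _ (M_sub _ _ xM)).
  by move/(memvZ c^-1); rewrite scalerK.
have sub_eM y : (y <= eR)%MS -> y \in M.
  by case/sub_rVP => a ->; apply: memvZ.
pose fR := realify R f.
have feR_neq0 : bform A fR eR != 0 by rewrite bform_realify intr_eq0.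
have fM a : fR *m realify R (Psi a) - fR \in M.
  (* x - k f is in e^perp, so it is moved by a multiple of e only *)
  pose k := bform A x eR / bform A fR eR.
  have k_neq0 : k != 0 by rewrite mulf_neq0 ?invr_eq0.
  have ve0 : bform A (x - k *: fR) eR = 0.
    by rewrite bformDl bformNl bformZl divfK // subrr.
  have [_ _ /(_ _ ve0)/sub_eM vM] := Psi_uni a.
  have := memvB (M_sub a _ xM) vM.
  suff -> : x *m realify R (Psi a) - x -
      ((x - k *: fR) *m realify R (Psi a) - (x - k *: fR)) =
      k *: (fR *m realify R (Psi a) - fR).
    by move/(memvZ k^-1); rewrite scalerK.
  rewrite mulmxBl -scalemxAl scalerBr.
  move: (x *m _) (k *: (fR *m _)) (k *: fR) => u v w.
  by apply/rowP => j; rewrite !mxE; ring.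
have WM (y : 'rV_(1 + r)) : y *m W \in M.
  rewrite -[y]hsubmxK /W map_col_mx mul_row_col; apply: memvD.
    by apply: sub_eM; exact: submxMl.
  rewrite mulmx_sum_row; apply: memv_suml => i _; apply: memvZ.
  by rewrite -map_row rowK map_mxB map_mxM.
have perp0 y : bform A y eR = 0 -> y *m (A *m eR^T) = 0.
  by move=> ye0; rewrite mulmxA [LHS]mx11_scalar [_ 0 0]ye0 raddf0.
have W_perp : W *m (A *m eR^T) = 0.
  rewrite /W map_col_mx mul_col_mx (perp0 _ eeR0) -[RHS]col_mx0; congr col_mx.
  apply/row_matrixP => i; rewrite row_mul row0 -map_row rowK map_mxB map_mxM.
  exact/perp0/bform_fixed_perp.
have perpM y : bform A y eR = 0 -> y \in M.
  move=> ye0; have : (y <= W)%MS.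
    apply: submx_trans (kermx_sub_row_free Wfree W_perp BeR_neq0).
    exact/sub_kermxP/perp0.
  by case/submxP => z ->; exact: WM.
apply/eqP; rewrite eqEsubv subvf; apply/subvP => y _.
pose k := bform A y eR / bform A x eR.
rewrite -(subrK (k *: x) y); apply: memvD; last exact: memvZ.
by apply: perpM; rewrite bformDl bformNl bformZl divfK // subrr.
Qed.
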